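(* Let $Y$ be a Banach space over $\mathbb{K}$. Then the norm of $Y$ is strongly subdifferentiable if, and only if, for every finite-dimensional subspace $X\subseteq Y$, the pair $(X,Y)$ is a BPB-pair.
   Context: $\mathbb{K}$ is $\mathbb{R}$ or $\mathbb{C}$; $B_Y$, $S_Y$, $Y^*$ denote the closed unit ball, the unit sphere and the dual of $Y$. The norm of $Y$ is strongly subdifferentiable (ssd) at $u\in S_Y$ if the limit $\lim_{\alpha\downarrow 0}\frac{\|u+\alpha y\|-1}{\alpha}$ exists uniformly for $y\in B_Y$; the norm of $Y$ is strongly subdifferentiable if this happens for all $u\in S_Y$. For a closed subspace $X$ of $Y$, $\Pi(X,Y)=\{(x,y^* )\in S_X\times S_{Y^*} : y^*(x)=1\}$. The pair $(X,Y)$ is a BPB-pair if for every $\varepsilon>0$ there exists $\delta>0$ such that whenever $x_0\in S_X$, $y_0^*\in S_{Y^*}$ satisfy $\mathrm{Re}\,y_0^*(x_0)>1-\delta$, there exists $(x,y^* )\in\Pi(X,Y)$ with $\|x_0-x\|<\varepsilon$ and $\|y_0^*-y^*\|<\varepsilon$. *)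

(* Defs.v *)
From HB Require Import structures.
From mathcomp Require Import all_boot all_order all_algebra complex.
From mathcomp Require Import all_classical all_reals all_analysis.

Set Implicit Arguments.
Unset Strict Implicit.
Unset Printing Implicit Defensive.

Import Order.TTheory GRing.Theory Num.Theory.
Import numFieldNormedType.Exports.

Local Open Scope classical_set_scope.
Local Open Scope ring_scope.
Local Open Scope complex_scope.

Variant scalars := RealScalars | ComplexScalars.

Definition scalar_field (R : realType) (k : scalars) : numFieldType :=
  match k with
  | RealScalars => R
  | ComplexScalars => R[i]
  end.

Definition re (R : realType) (k : scalars) : scalar_field R k -> R :=
  match k return scalar_field R k -> R with
  | RealScalars => fun z => z
  | ComplexScalars => fun z => complex.Re z
  end.

Definition of_real (R : realType) (k : scalars) : R -> scalar_field R k :=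
  match k return R -> scalar_field R k with
  | RealScalars => fun a => a
  | ComplexScalars => fun a => a%:C
  end.

(* In a normedModType over K, the norm is K-valued (a nonnegative real element
   of K when K = R[i]); it is turned into an element of R by re. *)
Definition rnorm (R : realType) (k : scalars)
  (V : normedModType (scalar_field R k)) (x : V) : R := re `|x|.

Section Banach.
Context (R : realType) (k : scalars).
Local Notation K := (scalar_field R k).
Context (Y : normedModType K).

Definition unit_ball : set Y := [set y | rnorm y <= 1].

Definition unit_sphere : set Y := [set y | rnorm y = 1].

Definition ssd_at (u : Y) : Prop :=
  exists l : Y -> R,
    {uniform unit_ball,
      (fun (a : R) (y : Y) => (rnorm (u + of_real k a *: y) - 1) / a) @ 0^'+
        --> l}.

Definition strongly_subdifferentiable : Prop :=
  forall u : Y, unit_sphere u -> ssd_at u.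

(* Meaningful for bounded functionals only (sup is 0 on unbounded sets);
   elements of the dual below are required to be continuous. *)
Definition dual_norm (f : Y -> K^o) : R :=
  sup [set rnorm (f y) | y in unit_ball].

Definition dual_sphere : set {linear Y -> K^o} :=
  [set f : {linear Y -> K^o} | continuous f /\ dual_norm f = 1].

Definition Pi_pair (X : set Y) : set (Y * {linear Y -> K^o}) :=
  [set p | [/\ X p.1, unit_sphere p.1, dual_sphere p.2 & p.2 p.1 = 1]].

Definition BPB_pair (X : set Y) : Prop :=
  forall eps : R, 0 < eps -> exists2 delta : R, 0 < delta &
    forall (x0 : Y) (f0 : {linear Y -> K^o}),
      X x0 -> unit_sphere x0 -> dual_sphere f0 ->
      re (f0 x0) > 1 - delta ->
      exists (x : Y) (f : {linear Y -> K^o}),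
        [/\ Pi_pair X (x, f), rnorm (x0 - x) < eps & dual_norm (f0 \- f) < eps].

Definition linear_subspace (X : set Y) : Prop :=
  X 0 /\ forall (a : K) (x y : Y), X x -> X y -> X (a *: x + y).

Definition finite_dimensional (X : set Y) : Prop :=
  exists (n : nat) (e : 'I_n -> Y), (forall i, X (e i)) /\
    forall x, X x -> exists c : 'I_n -> K, x = \sum_(i < n) c i *: e i.

End Banach.

(* Main.v *)
From HB Require Import structures.
Require Import Defs.
From mathcomp Require Import all_boot all_order all_algebra complex.
From mathcomp Require Import all_classical all_reals all_analysis.
From mathcomp Require Import ring lra.

Set Implicit Arguments.
Unset Strict Implicit.
Unset Printing Implicit Defensive.

Import Order.TTheory GRing.Theory Num.Theory.
Import numFieldNormedType.Exports.

Local Open Scope classical_set_scope.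
Local Open Scope ring_scope.
Local Open Scope complex_scope.

(** Strong subdifferentiability at a unit vector [u] has a dual form, namely that
    every [f] in the dual sphere with [re (f u)] close to [1] is close in norm to
    a support functional at [u], i.e. to some [g] of norm one with [g u = 1].
    Both halves of this duality use the difference quotients
    [(|u + a y| - 1) / a], which bound [re (g y)] from above for every support
    functional [g].

    If the quotients converge uniformly and [f] nearly attains its norm at [u],
    then [re f] exceeds the one-sided derivative of the norm by at most
    [eps * | . |], and a Hahn-Banach argument separates the two by a support
    functional [g] with [|f - g| <= eps] ([ssd_near_support]).  Conversely, a
    functional norming [u + a y] nearly attains its norm at [u], so a nearby
    support functional shows that the quotient is within [eps] of its limit,
    uniformly in [y] ([near_support_ssd]).

    Now let the norm be strongly subdifferentiable and [X] finite-dimensional.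
    The closeness at a point [x] of the unit sphere of [X] also handles all
    points near [x], with [x] itself as the point where the norm is attained;
    the unit sphere of [X] is compact, so one [delta] serves everywhere
    ([ssd_BPB_pair]).  Conversely, applying the BPB property to the line
    through [u] gives a functional attaining its norm at some [a *: u] with
    [|a| = 1] and [a] close to [1]; its multiple by [a] is a support functional
    at [u] ([line_BPB_near_support]).

    The Hahn-Banach theorem is used in the form of [proper_cone_linear]: a convex
    cone of requirements [g x <= r] is satisfied by a linear [g] unless it
    contains [g 0 <= r] with [r < 0].  It is a statement about real spaces; a
    [K]-linear functional is then recovered from its real part, and its norm is
    read off from its real part after a rotation. *)

(** * The Hahn-Banach theorem for convex cones *)

Section Cone.
Context (R : realType) (V : lmodType R).
Implicit Types (S : set (V * R)) (x y : V) (r s t : R).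

Definition convex_cone S :=
  [/\ S (0, 0),
      forall x y r s, S (x, r) -> S (y, s) -> S (x + y, r + s) &
      forall t x r, 0 < t -> S (x, r) -> S (t *: x, t * r)].

Definition proper_cone S := convex_cone S /\ forall r, S (0, r) -> 0 <= r.

Lemma proper_cone_opp S x r s :
  proper_cone S -> S (x, r) -> S (- x, s) -> 0 <= r + s.
Proof.
move=> [[_ SD _] S0] Sx Sn; apply: S0.
by rewrite -(subrr x); exact: SD.
Qed.

Lemma maximal_proper_cone S : proper_cone S ->
  exists M, [/\ S `<=` M, proper_cone M &
    forall M', M `<=` M' -> proper_cone M' -> M' `<=` M].
Proof.
move=> pS.
(* stated for the part added to [S], so that the empty chain is covered *)
pose P (A : set (V * R)) := proper_cone (S `|` A).
have [F FP totF|A [PA maxA]] := @Zorn_bigcup _ P.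
  have [S0 SD SZ] := pS.1.
  (* any two points of the union already lie in the enlargement of S by a
     single member of the chain, or in S itself when the chain is empty *)
  have common u v : (S `|` \bigcup_(X in F) X) u ->
      (S `|` \bigcup_(X in F) X) v ->
      exists B, [/\ proper_cone B, B u, B v & B `<=` S `|` \bigcup_(X in F) X].
    have FS X : F X -> S `|` X `<=` S `|` \bigcup_(X in F) X.
      by move=> FX w [Sw|Xw]; [left|right; exists X].
    move=> [Su|[X FX Xu]] [Sv|[X' FX' Xv]].
    - by exists S; split=> // w; left.
    - by exists (S `|` X'); split; [exact: FP|left|right|exact: FS].
    - by exists (S `|` X); split; [exact: FP|right|left|exact: FS].
    - have [XX'|XX'] := totF _ _ FX FX'.
        by exists (S `|` X'); split; [exact: FP|right; exact: XX'|right|exact: FS].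
      by exists (S `|` X); split; [exact: FP|right|right; exact: XX'|exact: FS].
  split; first split.
  - by left.
  - move=> x y r s Sx Sy.
    by have [B [[[_ BD _] _] Bx By BS]] := common _ _ Sx Sy; apply: BS; exact: BD.
  - move=> t x r t0 Sx.
    by have [B [[[_ _ BZ] _] Bx _ BS]] := common _ _ Sx Sx; apply: BS; exact: BZ.
  - by move=> r Sr; have [B [[_ +] Br _ _]] := common _ _ Sr Sr; exact.
exists (S `|` A); split=> //.
move=> M AM pM w Mw; apply: contrapT => nAw; apply: (maxA M).
  split=> [v Av|MA]; first by apply: AM; right.
  by apply: nAw; right; exact: MA.
by rewrite /P setUidr// => v Sv; apply: AM; left.
Qed.

(** Adjoining the ray through [(x, s)] keeps the cone proper as soon as that ray
    does not conflict with a bound already imposed at [- x]; maximality then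
    forces the ray to belong to the cone. *)
Lemma maximal_proper_cone_mem M x s :
  proper_cone M -> (forall M', M `<=` M' -> proper_cone M' -> M' `<=` M) ->
  (forall r, M (- x, r) -> 0 <= r + s) -> M (x, s).
Proof.
move=> [[M0 MD MZ] M_ge0] maxM xs.
pose M' : set (V * R) := [set w | exists z r t,
  [/\ 0 <= t, M (z, r) & w = (z + t *: x, r + t * s)]].
apply: (maxM M').
- by move=> [z r] Mz; exists z, r, 0; rewrite scale0r mul0r !addr0.
- split; first split.
  + by exists 0, 0, 0; split=> //; rewrite scale0r mul0r !addr0.
  + move=> _ _ _ _ [z1 [r1 [t1 [t10 Mz1 [-> ->]]]]] [z2 [r2 [t2 [t20 Mz2 [-> ->]]]]].
    exists (z1 + z2), (r1 + r2), (t1 + t2); split; [exact: addr_ge0|exact: MD|].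
    by rewrite (addrACA z1) (addrACA r1) scalerDl mulrDl.
  + move=> t _ _ t0 [z1 [r1 [t1 [t10 Mz1 [-> ->]]]]].
    exists (t *: z1), (t * r1), (t * t1); split; [|exact: MZ|].
      by rewrite mulr_ge0// ltW.
    by rewrite scalerDr mulrDr scalerA mulrA.
  + move=> _ [z [r [t [t0 Mz [/esym/eqP zx ->]]]]].
    move: zx; rewrite addr_eq0 => /eqP zx; rewrite zx in Mz.
    move: t0; rewrite le_eqVlt => /predU1P[t0|t0].
      by rewrite -t0 mul0r addr0; apply: M_ge0; move: Mz; rewrite -t0 scale0r oppr0.
    have := MZ t^-1 _ _ _ Mz; rewrite invr_gt0 => /(_ t0).
    rewrite scalerN scalerA mulVf ?gt_eqF// scale1r => /xs.
    by rewrite -(pmulr_rge0 _ t0) mulrDr mulVKf ?gt_eqF.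
- by exists 0, 0, 1; rewrite scale1r mul1r !add0r.
Qed.

(** The Hahn-Banach theorem, stated for the bounds rather than for a sublinear
    functional: a cone of requirements [g x <= r] that never asks for [0 < 0] is
    met by a linear [g].  A maximal such cone is the epigraph of a linear
    functional. *)
Theorem proper_cone_linear S : proper_cone S -> (forall x, exists r, S (x, r)) ->
  exists g : V -> R, [/\ forall x y, g (x + y) = g x + g y,
    forall t x, g (t *: x) = t * g x & forall x r, S (x, r) -> g x <= r].
Proof.
move=> pS totS.
have [M [SM pM maxM]] := maximal_proper_cone pS.
have memM x s := @maximal_proper_cone_mem M x s pM maxM.
have [[M0 MD MZ] M_ge0] := pM.
(* the value at [x] is the best bound that the maximal cone imposes there *)
have gP x : exists s, M (x, s) /\ M (- x, - s).
  have [r0 /SM Mr0] := totS x; have [r1 /SM Mr1] := totS (- x).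
  pose A := [set r | M (x, r)].
  have lbA r : M (- x, r) -> lbound A (- r).
    move=> Mr s As; have := proper_cone_opp pM As Mr.
    by rewrite addrC -lerBlDl sub0r.
  have hA : has_inf A by split; [exists r0|exists (- r1); exact: lbA].
  have Minf : M (x, inf A).
    apply: memM => r /lbA rA; rewrite addrC -lerBlDr sub0r.
    by apply: lb_le_inf => //; exists r0.
  exists (inf A); split=> //; apply: memM => r; rewrite opprK => Ar.
  by rewrite subr_ge0; apply: ge_inf => //; case: hA.
have uniqM x r s : M (x, r) -> M (- x, - r) -> M (x, s) -> M (- x, - s) -> r = s.
  move=> Mr Mr' Ms Ms'; apply/eqP; rewrite eq_le -(subr_ge0 r) -(subr_ge0 s).
  by rewrite (proper_cone_opp pM Ms Mr') (proper_cone_opp pM Mr Ms').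
have [g gM] := choice gP.
have gZ t x : 0 < t -> g (t *: x) = t * g x.
  move=> t0; have [gx gx'] := gM x; have [h h'] := gM (t *: x).
  apply: (uniqM _ _ _ h h' (MZ _ _ _ t0 gx)).
  by rewrite -scalerN -mulrN; exact: MZ.
have gN x : g (- x) = - g x.
  have [gx gx'] := gM x; have [h h'] := gM (- x).
  by apply: (uniqM _ _ _ h h' gx'); rewrite !opprK.
have g0 : g 0 = 0.
  by have [h h'] := gM 0; apply: (uniqM _ _ _ h h' M0); rewrite !oppr0.
exists g; split.
- move=> x y; have [gx gx'] := gM x; have [gy gy'] := gM y.
  have [h h'] := gM (x + y); apply: (uniqM _ _ _ h h' (MD _ _ _ _ gx gy)).
  by rewrite !opprD; exact: MD.
- move=> t x; have [t0|t0|->] := ltgtP t 0; last by rewrite scale0r mul0r.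
    rewrite -[t in LHS]opprK scaleNr gN gZ ?oppr_gt0//.
    by rewrite mulNr opprK.
  exact: gZ.
- move=> x r /SM Mr; have [_ gx'] := gM x.
  by have := proper_cone_opp pM Mr gx'; rewrite subr_ge0.
Qed.

End Cone.

(** * Real and complex scalars *)

Section Scalars.
Context (R : realType) (k : scalars).
Local Notation K := (scalar_field R k).
Implicit Types (z w : K) (a b : R).

Lemma reD z w : re (z + w) = re z + re w.
Proof. by case: k z w => //= -[? ?] [? ?]. Qed.

Lemma reN z : re (- z) = - re z.
Proof. by case: k z => //= -[? ?]. Qed.

Lemma reB z w : re (z - w) = re z - re w.
Proof. by rewrite reD reN. Qed.

Lemma re_of_real a : re (of_real k a) = a.
Proof. by case: k. Qed.

Lemma re_of_realM a z : re (of_real k a * z) = a * re z.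
Proof. by case: k z => //= -[? ?]/=; rewrite mul0r subr0. Qed.

Lemma of_real0 : of_real k (0 : R) = 0.
Proof. by case: k. Qed.

Lemma of_real1 : of_real k (1 : R) = 1.
Proof. by case: k. Qed.

Lemma of_realD a b : of_real k (a + b) = of_real k a + of_real k b.
Proof. by case: k => //=; rewrite rmorphD. Qed.

Lemma of_realM a b : of_real k (a * b) = of_real k a * of_real k b.
Proof. by case: k => //=; rewrite rmorphM. Qed.

Lemma of_real_eq0 a : (of_real k a == 0) = (a == 0).
Proof. by case: k => //=; rewrite fmorph_eq0. Qed.

Lemma ler_of_real a b : (of_real k a <= of_real k b) = (a <= b).
Proof. by case: k => //=; rewrite lecR. Qed.

Lemma of_real_re_ge0 z : 0 <= z -> of_real k (re z) = z.
Proof. by case: k z => //= -[x y]; rewrite lecE /= => /andP[/eqP->]. Qed.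

Lemma of_real_norm a : `|of_real k a| = of_real k `|a|.
Proof. by case: k => //=; rewrite normc_def/= expr0n addr0 sqrtr_sqr. Qed.

Lemma re_ge0 z : 0 <= z -> 0 <= re z.
Proof. by move=> z0; rewrite -ler_of_real of_real0 of_real_re_ge0. Qed.

Lemma re_le_norm z : re z <= re `|z|.
Proof.
rewrite -ler_of_real (of_real_re_ge0 (normr_ge0 z)).
case: k z => /= [|z]; first exact: ler_norm.
have zz : (complex.Re z)%:C <= `|complex.Re z|%:C by rewrite lecR ler_norm.
exact: le_trans zz (normc_ge_Re z).
Qed.

Lemma re_eq1 z : re z = 1 -> re `|z| <= 1 -> z = 1.
Proof.
rewrite -ler_of_real (of_real_re_ge0 (normr_ge0 z)).
case: k z => //= -[x y]/= ->; rewrite normc_def/= expr1n.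
rewrite lecR => h.
suff /eqP: y ^+ 2 = 0 by rewrite sqrf_eq0 => /eqP->.
apply/eqP; rewrite eq_le sqr_ge0 andbT.
have : Num.sqrt (1 + y ^+ 2) ^+ 2 <= 1 by rewrite expr_le1// sqrtr_ge0.
by rewrite sqr_sqrtr ?addr_ge0 ?sqr_ge0//; lra.
Qed.

Lemma rotate_to_norm z : exists w, `|w| = 1 /\ w * z = `|z|.
Proof.
have [->|z0] := eqVneq z 0; first by exists 1; rewrite normr1 mulr0 normr0.
exists (`|z| / z); rewrite divfK//; split=> //.
by rewrite normrM normfV normr_id divff// normr_eq0.
Qed.

End Scalars.

Arguments of_real0 {R} k.
Arguments of_real1 {R} k.
Arguments of_realD {R} k a b.
Arguments of_realM {R} k a b.
Arguments ler_of_real {R} k a b.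
Arguments of_real_eq0 {R} k a.

Section RealNorm.
Context (R : realType) (k : scalars).
Local Notation K := (scalar_field R k).
Context (V : normedModType K).
Implicit Types (x y : V) (a : R).

Lemma of_real_rnorm x : of_real k (rnorm x) = `|x|.
Proof. exact: of_real_re_ge0. Qed.

Lemma rnorm_ge0 x : 0 <= rnorm x.
Proof. exact: re_ge0. Qed.

Lemma rnorm0 : rnorm (0 : V) = 0.
Proof. by rewrite /rnorm normr0 -of_real0 re_of_real. Qed.

Lemma rnorm_eq0 x : (rnorm x == 0) = (x == 0).
Proof. by rewrite -(of_real_eq0 k) of_real_rnorm normr_eq0. Qed.

Lemma rnormN x : rnorm (- x) = rnorm x.
Proof. by rewrite /rnorm normrN. Qed.

Lemma ler_rnormD x y : rnorm (x + y) <= rnorm x + rnorm y.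
Proof. by rewrite -(ler_of_real k) of_realD !of_real_rnorm ler_normD. Qed.

Lemma ler_rnormB x y : rnorm (x - y) <= rnorm x + rnorm y.
Proof. by rewrite -(rnormN y) ler_rnormD. Qed.

Lemma rnorm_distC x y : rnorm (x - y) = rnorm (y - x).
Proof. by rewrite -rnormN opprB. Qed.

Lemma rnormZ (c : K) x : rnorm (c *: x) = re `|c| * rnorm x.
Proof. by rewrite /rnorm normrZ -(of_real_re_ge0 (normr_ge0 c)) re_of_realM re_of_real. Qed.

Lemma rnormZ_real a x : rnorm (of_real k a *: x) = `|a| * rnorm x.
Proof. by rewrite rnormZ of_real_norm re_of_real. Qed.

End RealNorm.

(** A copy of [Y] whose only module structure is the real one, so that the cones
    above can be formed over [Y] whatever the scalar field is. *)
Definition realified (R : realType) (k : scalars)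
  (Y : normedModType (scalar_field R k)) : Type := Y.

Section Realified.
Context (R : realType) (k : scalars) (Y : normedModType (scalar_field R k)).

HB.instance Definition _ := GRing.Zmodule.copy (realified Y) Y.

Let real_scale (a : R) (y : realified Y) : realified Y := of_real k a *: (y : Y).

Let real_scaleA a b y : real_scale a (real_scale b y) = real_scale (a * b) y.
Proof. by rewrite /real_scale scalerA of_realM. Qed.

Let real_scale1 : left_id 1 real_scale.
Proof. by move=> y; rewrite /real_scale of_real1 scale1r. Qed.

Let real_scaleDr : right_distributive real_scale +%R.
Proof. by move=> a x y; rewrite /real_scale scalerDr. Qed.

Let real_scaleDl y : {morph real_scale^~ y : a b / a + b}.
Proof. by move=> a b; rewrite /real_scale of_realD scalerDl. Qed.

HB.instance Definition _ := GRing.Zmodule_isLmodule.Build R (realified Y)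
  real_scaleA real_scale1 real_scaleDr real_scaleDl.

Lemma realified_scaleE (a : R) (y : Y) :
  a *: (y : realified Y) = of_real k a *: y.
Proof. by []. Qed.

End Realified.

(** * Functionals and their real parts *)

Section Dual.
Context (R : realType) (k : scalars).
Local Notation K := (scalar_field R k).
Context (Y : normedModType K).
Implicit Types (f g : {linear Y -> K^o}) (x y u : Y) (M : R).

(** A real functional is the real part of a unique [K]-linear one; over the
    complex numbers this is [y |-> g y - i g (i y)]. *)
Lemma re_linear (g : Y -> R) :
    (forall x y, g (x + y) = g x + g y) ->
    (forall a y, g (of_real k a *: y) = a * g y) ->
  exists G : {linear Y -> K^o}, forall y, re (G y) = g y.
Proof.
case: k Y g => /= [Z|Z] g gD gZ.
  have lin : linear (g : Z -> R^o) by move=> a x y; rewrite gD gZ.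
  pose L := GRing.isLinear.Build _ _ _ _ (g : Z -> R^o) lin.
  pose G : {linear Z -> R^o} := HB.pack (g : Z -> R^o) L.
  by exists G.
pose f (y : Z) : (R[i])^o := (g y +i* - g ('i *: y))%C.
have lin : linear f.
  move=> [a b] x y; rewrite /f.
  have -> : (a +i* b)%C = a%:C + b%:C * 'i :> R[i] by simpc.
  have E1 : (a%:C + b%:C * 'i) *: x = a%:C *: x + b%:C *: ('i *: x).
    by rewrite scalerDl scalerA.
  have E2 : 'i *: (a%:C *: x + b%:C *: ('i *: x) + y) =
      a%:C *: ('i *: x) + (- b)%:C *: x + 'i *: y.
    rewrite !scalerDr !scalerA; congr (_ *: _ + _ *: _ + _); simpc => //.
  rewrite E1 E2 !gD !gZ /GRing.scale/=; simpc; congr (_ +i* _)%C; ring.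
pose L := GRing.isLinear.Build _ _ _ _ f lin.
pose G : {linear Z -> (R[i])^o} := HB.pack f L.
by exists G.
Qed.

Lemma proper_cone_re_linear (S : set (realified Y * R)) :
    proper_cone S -> (forall x, exists r, S (x, r)) ->
  exists G : {linear Y -> K^o}, forall y r, S (y, r) -> re (G y) <= r.
Proof.
move=> pS totS; have [g [gD gZ gS]] := proper_cone_linear pS totS.
have [G Gg] := @re_linear g gD gZ.
by exists G => y r /gS; rewrite Gg.
Qed.

Lemma re_le_rnorm f y : re (f y) <= rnorm (f y).
Proof. exact: re_le_norm. Qed.

(** Multiplying [y] by a scalar of modulus one makes [f y] real and nonnegative
    without changing [|y|], so a bound on the real part bounds the modulus. *)
Lemma rnorm_le_of_re f M :
  (forall y, re (f y) <= M * rnorm y) -> forall y, rnorm (f y) <= M * rnorm y.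
Proof.
move=> fM y; have [w [w1 wfy]] := rotate_to_norm (f y : K).
have := fM (w *: y); rewrite linearZ /= rnormZ w1.
by rewrite -[re 1]/(re (1 : K)) -(of_real1 k) re_of_real mul1r /GRing.scale/= wfy.
Qed.

Lemma continuous_rnorm_le f M :
  (forall y, rnorm (f y) <= M * rnorm y) -> continuous f.
Proof.
move=> fM; apply: bounded_linear_continuous; apply/linear_boundedP.
exists (of_real k M); split; first by rewrite realE -(of_real0 k) !ler_of_real le_total.
move=> r Mr x; apply: (@le_trans _ _ (of_real k M * `|x|)).
  by rewrite -!of_real_rnorm -of_realM ler_of_real.
by rewrite ler_wpM2r// ltW.
Qed.

Lemma dual_norm_le (f : Y -> K^o) M :
  0 <= M -> (forall y, rnorm (f y) <= M * rnorm y) -> dual_norm f <= M.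
Proof.
move=> M0 fM; apply: ge_sup.
  by exists (rnorm (f 0)); exists 0 => //=; rewrite /unit_ball/= rnorm0.
move=> _ [y y1 <-]; apply: le_trans (fM y) _.
by rewrite -[leRHS]mulr1 ler_wpM2l.
Qed.

Lemma le_dual_norm f : continuous f ->
  forall y, rnorm (f y) <= dual_norm f * rnorm y.
Proof.
move=> cf.
have /linear_boundedP/pinfty_ex_gt0 [M M0 fM] :
  bounded_near f (nbhs 0) by apply/linear_bounded_continuous.
have fM' y : rnorm (f y) <= re M * rnorm y.
  rewrite -(ler_of_real k) of_realM (of_real_re_ge0 (ltW M0)) !of_real_rnorm.
  exact: fM.
have ub : has_ubound [set rnorm (f y) | y in unit_ball (Y := Y)].
  exists (re M) => _ [y y1 <-]; apply: le_trans (fM' y) _.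
  by rewrite -[leRHS]mulr1 ler_wpM2l// re_ge0// ltW.
move=> y; have [->|y0] := eqVneq y 0; first by rewrite linear0 !rnorm0 mulr0.
have ny : 0 < rnorm y by rewrite lt_neqAle eq_sym rnorm_eq0 y0 rnorm_ge0.
rewrite -ler_pdivrMr// mulrC.
suff -> : (rnorm y)^-1 * rnorm (f y) = rnorm (f (of_real k (rnorm y)^-1 *: y)).
  apply: ub_le_sup => //; exists (of_real k (rnorm y)^-1 *: y) => //.
  by rewrite /unit_ball/= rnormZ_real gtr0_norm ?invr_gt0// mulVf ?gt_eqF.
by rewrite linearZ /= rnormZ_real gtr0_norm ?invr_gt0.
Qed.

Lemma dual_sphere_le f : dual_sphere f -> forall y, rnorm (f y) <= rnorm y.
Proof. by move=> [cf f1] y; rewrite -[leRHS]mul1r -f1; exact: le_dual_norm. Qed.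

Lemma dual_sphere_re_le f : dual_sphere f -> forall y, re (f y) <= rnorm y.
Proof. by move=> fS y; apply: le_trans (re_le_rnorm f y) (dual_sphere_le fS y). Qed.

Lemma dual_norm_subP f g M : 0 <= M -> dual_sphere f -> dual_sphere g ->
  dual_norm (f \- g) <= M -> forall y, rnorm (f y - g y) <= M * rnorm y.
Proof.
move=> M0 [cf _] [cg _] fgM y.
have cfg : continuous (f \- g) by move=> z; apply: cvgB; [exact: cf|exact: cg].
apply: le_trans (le_dual_norm (f := f \- g) cfg y) _.
by rewrite ler_wpM2r// rnorm_ge0.
Qed.

(** The real part bounds the modulus, and a scalar of modulus at most one whose
    real part is [1] is [1]; so real inequalities suffice for [f] to be a support
    functional at [u]. *)
Lemma support_functionalP f u : rnorm u = 1 ->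
  (forall y, re (f y) <= rnorm y) -> 1 <= re (f u) -> dual_sphere f /\ f u = 1.
Proof.
move=> u1 fle fu.
have fN y : rnorm (f y) <= 1 * rnorm y by apply: rnorm_le_of_re => {}y; rewrite mul1r.
have cf : continuous f by exact: continuous_rnorm_le fN.
have fu1 : f u = 1.
  apply: (@re_eq1 R k).
    by apply/eqP; rewrite eq_le fu andbT -u1 fle.
  by have := fN u; rewrite u1 mul1r.
split=> //; split=> //; apply/eqP; rewrite eq_le dual_norm_le//=.
have := le_dual_norm cf u; rewrite fu1 u1 mulr1; apply: le_trans.
by rewrite /rnorm normr1 -(of_real1 k) re_of_real.
Qed.

(** The bounds [g y <= |y|] and [g (- u) <= - |u|] form a proper cone, so every
    vector is normed by a functional of norm at most one. *)
Lemma norming_functional u : exists f : {linear Y -> K^o},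
  (forall y, re (f y) <= rnorm y) /\ re (f u) = rnorm u.
Proof.
pose S : set (realified Y * R) := [set w | exists t : R,
  0 <= t /\ rnorm ((w.1 : Y) + of_real k t *: u) - t * rnorm u <= w.2].
have pS : proper_cone S.
  split; first split.
  - by exists 0; split=> //=; rewrite of_real0 scale0r addr0 rnorm0 mul0r subr0.
  - move=> x y r s [t [t0 /= tx]] [t' [t'0 /= ty]]; exists (t + t').
    split=> /=; first exact: addr_ge0.
    have := ler_rnormD ((x : Y) + of_real k t *: u) ((y : Y) + of_real k t' *: u).
    rewrite addrACA -scalerDl -of_realD; lra.
  - move=> a x r a0 [t [t0 /= tx]]; exists (a * t).
    split=> /=; first by rewrite mulr_ge0// ltW.
    rewrite realified_scaleE of_realM -scalerA -scalerDr rnormZ_real gtr0_norm//.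
    by rewrite -mulrA -mulrBr ler_pM2l.
  - move=> r [t [t0 /=]]; rewrite add0r rnormZ_real ger0_norm// subrr.
    by [].
have totS x : exists r, S (x, r).
  exists (rnorm (x : Y)), 0.
  by split=> //=; rewrite of_real0 scale0r addr0 mul0r subr0.
have [f fS] := proper_cone_re_linear pS totS.
have fle y : re (f y) <= rnorm y.
  by apply: fS; exists 0; split=> //=; rewrite of_real0 scale0r addr0 mul0r subr0.
exists f; split=> //; apply/eqP; rewrite eq_le fle/=.
rewrite -lerN2 -reN -linearN; apply: fS; exists 1.
by split=> //=; rewrite of_real1 scale1r addNr rnorm0 mul1r sub0r.
Qed.

End Dual.

(** * Subdifferentiability and support functionals *)

Section DifferenceQuotient.
Context (R : realType) (k : scalars).
Local Notation K := (scalar_field R k).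
Context (Y : normedModType K) (u : Y) (u1 : rnorm u = 1).
Implicit Types (a b t : R) (x y z : Y).

Let re_affine (f : {linear Y -> K^o}) a x y :
  re (f (x + of_real k a *: y)) = re (f x) + a * re (f y).
Proof. by rewrite linearD linearZ /= reD re_of_realM. Qed.

Definition dquot a y : R := (rnorm (u + of_real k a *: y) - 1) / a.

(** The parameter [a * b / (a + b)] makes [u + c (x + y)] the convex combination
    of [u + a x] and [u + b y] with weights [b / (a + b)] and [a / (a + b)].  This
    gives subadditivity for the quotients themselves, before any limit. *)
Lemma dquotD a b x y : 0 < a -> 0 < b ->
  dquot (a * b / (a + b)) (x + y) <= dquot a x + dquot b y.
Proof.
move=> a0 b0; have ab0 : 0 < a + b by rewrite addr_gt0.
set c := a * b / (a + b); have c0 : 0 < c by rewrite divr_gt0 ?mulr_gt0.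
have E : of_real k (a + b) *: (u + of_real k c *: (x + y)) =
    of_real k b *: (u + of_real k a *: x) + of_real k a *: (u + of_real k b *: y).
  rewrite !scalerDr !scalerA -!of_realM [b * a]mulrC.
  have -> : (a + b) * c = a * b by rewrite /c; field; rewrite gt_eqF.
  by rewrite addrACA -scalerDl -of_realD [b + a]addrC.
have := ler_rnormD (of_real k b *: (u + of_real k a *: x))
                   (of_real k a *: (u + of_real k b *: y)).
rewrite -E !rnormZ_real !gtr0_norm// /dquot.
set N := rnorm _; set Na := rnorm _; set Nb := rnorm _ => le_N.
have -> : (Na - 1) / a + (Nb - 1) / b = (b * Na + a * Nb - (a + b)) / (a * b).
  by field; rewrite !gt_eqF.
have -> : (N - 1) / c = ((a + b) * N - (a + b)) / (a * b).
  by rewrite /c; field; rewrite !gt_eqF.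
by rewrite ler_pM2r ?invr_gt0 ?mulr_gt0// lerD2r.
Qed.

Lemma dquotZ a t y : 0 < t -> dquot a (of_real k t *: y) = t * dquot (a * t) y.
Proof.
move=> t0; rewrite /dquot scalerA -of_realM.
have [->|a0] := eqVneq a 0; first by rewrite mul0r invr0 !mulr0.
by field; rewrite a0 gt_eqF.
Qed.

Lemma dquot_mono a b y : 0 < a -> a <= b -> dquot a y <= dquot b y.
Proof.
move=> a0 ab; have b0 : 0 < b by exact: lt_le_trans ab.
have E : of_real k b *: (u + of_real k a *: y) =
    of_real k (b - a) *: u + of_real k a *: (u + of_real k b *: y).
  rewrite !scalerDr !scalerA -!of_realM [b * a]mulrC addrA -scalerDl.
  by rewrite -of_realD subrK.
have := ler_rnormD (of_real k (b - a) *: u) (of_real k a *: (u + of_real k b *: y)).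
rewrite -E !rnormZ_real u1 mulr1 (gtr0_norm a0) (gtr0_norm b0).
rewrite (ger0_norm (_ : 0 <= b - a)) ?subr_ge0//.
rewrite /dquot; set Na := rnorm _; set Nb := rnorm _ => le_N.
rewrite ler_pdivrMr// mulrAC ler_pdivlMr//; lra.
Qed.

Lemma dquot_le_rnorm a y : 0 < a -> dquot a y <= rnorm y.
Proof.
move=> a0; rewrite /dquot ler_pdivrMr//.
have := ler_rnormD u (of_real k a *: y).
rewrite rnormZ_real gtr0_norm// u1; lra.
Qed.

Lemma dquot0 a : dquot a 0 = 0.
Proof. by rewrite /dquot scaler0 addr0 u1 subrr mul0r. Qed.

Lemma dquotNu : dquot 1 (- u) = - 1.
Proof. by rewrite /dquot of_real1 scale1r subrr rnorm0 divr1 sub0r. Qed.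

Lemma ssd_at_dquotP : ssd_at u <-> exists l : Y -> R, forall eps : R, 0 < eps ->
  exists2 a0 : R, 0 < a0 & forall a y, 0 < a -> a < a0 -> rnorm y <= 1 ->
    `|l y - dquot a y| < eps.
Proof.
split=> [[l ssd]|[l dl]]; exists l.
- move=> eps eps0.
  have : nbhs (l : {uniform` unit_ball (Y := Y) -> R})
      [set h | forall y, unit_ball y -> `|l y - h y| < eps].
    apply/uniform_nbhs; exists [set p : R * R | `|p.1 - p.2| < eps]; split=> //.
    exact: (entourage_ball R (PosNum eps0)).
  move=> /ssd [a0 /= a00 sub]; exists a0 => // a y a_gt0 aa0 y1.
  apply: (sub a) => //=; by rewrite sub0r normrN gtr0_norm.
- move=> P /uniform_nbhs[E [entE EP]].
  have [e /= e0 eE] : exists2 e : R, 0 < e & [set p | `|p.1 - p.2| < e] `<=` E.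
    by move: entE; rewrite -entourage_ballE => -[e e0 eE]; exists e.
  have [a0 a00 h] := dl _ e0.
  exists a0 => //= a /=; rewrite sub0r normrN => + a_gt0; rewrite gtr0_norm// => aa0.
  by apply: EP => y y1; apply: eE => /=; exact: h.
Qed.

(** If [f] nearly attains its norm at [u], then [re f <= tau + eps * | . |] for
    the one-sided derivative [tau] of the norm at [u].  The requirements
    [re g <= tau] and [re (g - f) <= eps * | . |] are then compatible: the cone
    they generate is proper.  The quotients serve in place of their infimum
    [tau], and [re g <= tau] makes [g] a support functional. *)
Lemma ssd_near_support : ssd_at u -> forall eps : R, 0 < eps ->
  exists2 delta : R, 0 < delta & forall f : {linear Y -> K^o},
    dual_sphere f -> 1 - delta < re (f u) ->
    exists g : {linear Y -> K^o},
      [/\ dual_sphere g, g u = 1 & dual_norm (f \- g) <= eps].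
Proof.
move=> /ssd_at_dquotP[l dl] eps eps0.
have [a0 a00 dla] := dl (eps / 4) ltac:(lra).
pose a1 := a0 / 2.
exists (a1 * (eps / 2)); first by rewrite /a1 !mulr_gt0// ?invr_gt0.
move=> f fS fu.
(* at a parameter below [a1] the quotient is uniformly close to its limit, and it
   only grows with the parameter *)
have fq1 y b : 0 < b -> rnorm y = 1 -> re (f y) <= dquot b y + eps.
  move=> b0 y1; pose b' := Num.min b a1.
  have b'0 : 0 < b' by rewrite lt_min b0/= /a1; lra.
  have bb' : dquot b' y <= dquot b y by apply: dquot_mono => //; rewrite ge_min lexx.
  have b'a : b' <= a1 by rewrite ge_min lexx orbT.
  have a1a0 : a1 < a0 by rewrite /a1; lra.
  have a10 : 0 < a1 by rewrite /a1; lra.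
  have := dla b' y b'0 (le_lt_trans b'a a1a0) ltac:(by rewrite y1).
  have := dla a1 y a10 a1a0 ltac:(by rewrite y1).
  rewrite !ltr_norml => /andP[h1 _] /andP[_ h2].
  suff : re (f y) <= dquot a1 y + eps / 2 by lra.
  have := dual_sphere_re_le fS (u + of_real k a1 *: y).
  rewrite re_affine => h3.
  rewrite -lerBlDr /dquot ler_pdivlMr//; lra.
have fq y b : 0 < b -> re (f y) <= dquot b y + eps * rnorm y.
  move=> b0; have [->|y0] := eqVneq y 0.
    by rewrite linear0 dquot0 rnorm0 mulr0 addr0 -(of_real0 k) re_of_real.
  have ny : 0 < rnorm y by rewrite lt_neqAle eq_sym rnorm_eq0 y0 rnorm_ge0.
  pose v := of_real k (rnorm y)^-1 *: y.
  have yv : y = of_real k (rnorm y) *: v.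
    by rewrite /v scalerA -of_realM divff ?gt_eqF// of_real1 scale1r.
  have v1 : rnorm v = 1 by rewrite /v rnormZ_real gtr0_norm ?invr_gt0// mulVf ?gt_eqF.
  rewrite {1 2}yv linearZ /= re_of_realM dquotZ// [eps * _]mulrC -mulrDr.
  by rewrite ler_pM2l// fq1// mulr_gt0.
pose S : set (realified Y * R) := [set w | exists a (x z : Y),
  [/\ 0 < a, w.1 = x + z & dquot a x + re (f z) + eps * rnorm z <= w.2]].
have S_dquot y b : 0 < b -> S (y, dquot b y).
  move=> b0; exists b, y, 0; split=> //=; first by rewrite addr0.
  by rewrite linear0 rnorm0 mulr0 addr0 -(of_real0 k) re_of_real addr0.
have S_f y : S (y, re (f y) + eps * rnorm y).
  by exists 1, 0, y; split=> //=; rewrite ?add0r// dquot0 add0r.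
have pS : proper_cone S.
  split; first split.
  - by rewrite -[0 in X in (_, X)](dquot0 1); exact: S_dquot.
  - move=> _ _ r s [a [x [z [a_gt0 /= -> xr]]]] [b [x' [z' [b0 /= -> xs]]]].
    exists (a * b / (a + b)), (x + x'), (z + z').
    split=> /=; [by rewrite divr_gt0 ?mulr_gt0 ?addr_gt0|by rewrite addrACA|].
    have := dquotD x x' a_gt0 b0; have := ler_rnormD z z'.
    rewrite -(ler_pM2l eps0) linearD reD; lra.
  - move=> t _ r t0 [a [x [z [a_gt0 /= -> xr]]]].
    exists (a / t), (of_real k t *: x), (of_real k t *: z).
    split=> /=; [by rewrite divr_gt0|by rewrite realified_scaleE scalerDr|].
    rewrite dquotZ// divfK ?gt_eqF// linearZ /= re_of_realM rnormZ_real gtr0_norm//.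
    by rewrite (mulrCA eps) -!mulrDr ler_pM2l.
  - move=> r [a [x [z [a_gt0 /= /esym/eqP]]]]; rewrite addrC addr_eq0 => /eqP -> .
    rewrite linearN reN rnormN; have := fq x a a_gt0; lra.
have [g gS] := proper_cone_re_linear pS (fun y => ex_intro (fun r => S (y, r)) _ (S_f y)).
have [|gD gu] := support_functionalP u1 (f := g)
    (fun y => le_trans (gS _ _ (S_dquot y 1 ltr01)) (dquot_le_rnorm y ltr01)).
  by have := gS _ _ (S_dquot (- u) 1 ltr01); rewrite dquotNu linearN reN lerN2.
exists g; split=> //; apply: dual_norm_le; first exact: ltW.
apply: (@rnorm_le_of_re _ _ _ (f \- g)) => y /=.
have := gS _ _ (S_f (- y)); rewrite !linearN !reN rnormN reB /=; lra.
Qed.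

Lemma dquot_ge_support a y (g : {linear Y -> K^o}) :
  0 < a -> dual_sphere g -> g u = 1 -> re (g y) <= dquot a y.
Proof.
move=> a0 gS gu; have := dual_sphere_re_le gS (u + of_real k a *: y).
rewrite re_affine gu -(of_real1 k) re_of_real => h.
by rewrite /dquot ler_pdivlMr//; lra.
Qed.

(** A functional norming [u + a y] nearly attains its norm at [u], hence is close
    to a support functional; so the quotient is squeezed between the supremum of
    [re (g y)] over the support functionals [g] at [u] and that supremum plus
    [eps]. *)
Lemma near_support_ssd :
  (forall eps : R, 0 < eps -> exists2 delta : R, 0 < delta &
    forall f : {linear Y -> K^o}, dual_sphere f -> 1 - delta < re (f u) ->
    exists g : {linear Y -> K^o},
      [/\ dual_sphere g, g u = 1 & dual_norm (f \- g) <= eps]) ->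
  ssd_at u.
Proof.
move=> near_supp; apply/ssd_at_dquotP.
pose D y := [set re (g y) | g in [set g : {linear Y -> K^o} | dual_sphere g /\ g u = 1]].
have D_ub y : has_ubound (D y).
  exists (rnorm y) => _ [g [gS gu] <-].
  exact: le_trans (dquot_ge_support y ltr01 gS gu) (dquot_le_rnorm y ltr01).
exists (fun y => sup (D y)) => eps eps0.
have [delta delta0 hd] := near_supp (eps / 2) ltac:(lra).
exists (Num.min (delta / 2) 1); first by rewrite lt_min ltr01 divr_gt0.
move=> a y a0; rewrite lt_min => /andP[ad a1] y1.
have [f [fle fn]] := norming_functional (u + of_real k a *: y).
have ny : 1 - a <= rnorm (u + of_real k a *: y).
  have := ler_rnormB (u + of_real k a *: y) (of_real k a *: y).
  rewrite addrK u1 rnormZ_real gtr0_norm//.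
  have : a * rnorm y <= a by rewrite -[leRHS]mulr1 ler_pM2l.
  lra.
have fy : re (f y) <= 1 by exact: le_trans (fle y) y1.
have fyN : a * re (f y) <= a by rewrite -[leRHS]mulr1 ler_pM2l.
move: fn; rewrite re_affine => fn.
have fS : dual_sphere f.
  have fN z : rnorm (f z) <= 1 * rnorm z.
    by apply: rnorm_le_of_re => {}z; rewrite mul1r.
  have cf := continuous_rnorm_le fN.
  split=> //; apply/eqP; rewrite eq_le dual_norm_le//=.
  set w := u + of_real k a *: y in ny fn *.
  have w0 : 0 < rnorm w by lra.
  rewrite -(ler_pM2r w0) mul1r -[leLHS]fn.
  apply: le_trans (le_dual_norm cf w); apply: le_trans (re_le_rnorm f w).
  by rewrite /w re_affine.
have [g [gS gu fg]] := hd f fS ltac:(lra).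
have gD : re (g y) <= sup (D y) by apply: ub_le_sup => //; exists g.
have Dq : sup (D y) <= dquot a y.
  apply: ge_sup; first by exists (re (g y)), g.
  by move=> _ [h [hS hu] <-]; exact: dquot_ge_support.
have qf : dquot a y <= re (f y).
  by rewrite /dquot ler_pdivrMr// -fn; have := dual_sphere_re_le fS u; rewrite u1; lra.
have fgy : re (f y) - re (g y) <= eps / 2.
  rewrite -reB; apply: le_trans (re_le_norm _) _.
  have eps2 : 0 < eps / 2 by lra.
  apply: le_trans (dual_norm_subP (ltW eps2) fS gS fg y) _.
  by rewrite -[leRHS]mulr1 ler_pM2l.
rewrite ltr_norml; apply/andP; split; lra.
Qed.

End DifferenceQuotient.

(** * Compactness of finite-dimensional spheres *)

Section RealCombinations.
Context (R : realType) (k : scalars).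
Local Notation K := (scalar_field R k).
Context (Y : normedModType K).
Implicit Types (X : set Y) (m : nat).

Definition real_comb m (e : 'I_m -> Y) (c : 'rV[R]_m) : Y :=
  \sum_(i < m) of_real k (c 0 i) *: e i.

Lemma real_combD m (e : 'I_m -> Y) c d :
  real_comb e (c + d) = real_comb e c + real_comb e d.
Proof.
rewrite /real_comb -big_split/=; apply: eq_bigr => i _.
by rewrite mxE of_realD scalerDl.
Qed.

Lemma real_combZ m (e : 'I_m -> Y) (a : R) c :
  real_comb e (a *: c) = of_real k a *: real_comb e c.
Proof.
rewrite /real_comb scaler_sumr; apply: eq_bigr => i _.
by rewrite mxE of_realM scalerA.
Qed.

Lemma real_combB m (e : 'I_m -> Y) c d :
  real_comb e (c - d) = real_comb e c - real_comb e d.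
Proof.
apply/eqP; rewrite eq_sym subr_eq; apply/eqP.
by rewrite -real_combD subrK.
Qed.

Lemma subspace_real_comb X m (e : 'I_m -> Y) c :
  linear_subspace X -> (forall i, X (e i)) -> X (real_comb e c).
Proof.
move=> [X0 XD] Xe; rewrite /real_comb; elim/big_ind : _ => //.
  by move=> x y Xx Xy; rewrite -[x]scale1r; exact: XD.
by move=> i _; rewrite -[_ *: _]addr0; exact: XD.
Qed.

Definition real_generators X m (e : 'I_m -> Y) :=
  (forall i, X (e i)) /\ forall x, X x -> exists c, x = real_comb e c.

(** Over the complex numbers the vectors [e i] and [i e i] generate with real
    coefficients, so that compactness is only needed in [R^m]. *)
Lemma finite_dimensional_real_generators X :
  linear_subspace X -> finite_dimensional X ->
  exists m (e : 'I_m -> Y), real_generators X e.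
Proof.
rewrite /real_generators /real_comb.
case: k Y X => /= Z X [X0 XD] [n [e [Xe genX]]].
  exists n, e; split=> // x /genX[c ->]; exists (\row_i c i).
  by apply: eq_bigr => i _; rewrite mxE.
pose e' (j : 'I_(n + n)) : Z :=
  match fintype.split j with inl i => e i | inr i => 'i *: e i end.
exists (n + n)%N, e'; split.
  move=> j; rewrite /e'; case: fintype.split => i; first exact: Xe.
  by rewrite -[_ *: _]addr0; exact: XD.
move=> x /genX[c ->].
exists (row_mx (\row_i complex.Re (c i)) (\row_i complex.Im (c i))).
rewrite big_split_ord/= -big_split/=; apply: eq_bigr => i _.
rewrite row_mxEl row_mxEr !mxE /e'.
rewrite (unsplitK (inl i)) (unsplitK (inr i)) scalerA -scalerDl; congr (_ *: _).
by case: (c i) => a b /=; simpc.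
Qed.

(** A nontrivial relation among the generators lets one of them be dropped. *)
Lemma independent_real_generators X m (e : 'I_m -> Y) : real_generators X e ->
  exists m' (e' : 'I_m' -> Y), real_generators X e' /\
    forall c, real_comb e' c = 0 -> c = 0.
Proof.
elim: m e => [|m IH] e [Xe genX].
  by exists 0%N, e; split=> // c _; apply/rowP => -[].
have [inj|] := pselect (forall c, real_comb e c = 0 -> c = 0).
  by exists m.+1, e.
move=> /existsNP[c /not_implyP[c_rel c0]].
have [j cj] : exists j, c 0 j != 0.
  apply: contrapT => /forallNP h; apply: c0; apply/rowP => j; rewrite mxE.
  by apply/eqP; have /negP := h j; rewrite negbK.
apply: (IH (e \o lift j)); split=> [i|x /genX[d ->]]; first exact: Xe.
pose d' := d - (d 0 j / c 0 j) *: c.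
have d'j : d' 0 j = 0 by rewrite !mxE divfK// subrr.
have -> : real_comb e d = real_comb e d'.
  by rewrite real_combB real_combZ c_rel scaler0 subr0.
exists (\row_i d' 0 (lift j i)).
rewrite /real_comb (bigD1_ord j)//= d'j of_real0 scale0r add0r.
by apply: eq_bigr => i _; congr (of_real k _ *: _); rewrite [RHS]mxE.
Qed.

Lemma rnorm_sum m (F : 'I_m -> Y) :
  rnorm (\sum_(i < m) F i) <= \sum_(i < m) rnorm (F i).
Proof.
elim/big_rec2 : _ => [|i b x _ xb]; first by rewrite rnorm0.
by apply: le_trans (ler_rnormD _ _) _; rewrite lerD2l.
Qed.

Lemma ler_mx_norm m (c : 'rV[R]_m) i : `|c 0 i| <= `|c|.
Proof.
rewrite [leRHS]/Num.norm/= mx_normrE.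
by apply: (le_bigmax _ (fun ij => `|c ij.1 ij.2|) (0, i)).
Qed.

Lemma rnorm_real_comb_le m (e : 'I_m -> Y) c :
  rnorm (real_comb e c) <= (\sum_(i < m) rnorm (e i)) * `|c|.
Proof.
apply: le_trans (rnorm_sum _) _; rewrite mulr_suml; apply: ler_sum => i _.
by rewrite rnormZ_real mulrC ler_wpM2l ?rnorm_ge0// ler_mx_norm.
Qed.

Lemma real_comb_near m (e : 'I_m -> Y) c (eps : R) : 0 < eps ->
  \forall d \near c, rnorm (real_comb e c - real_comb e d) < eps.
Proof.
move=> eps0; pose L := \sum_(i < m) rnorm (e i) + 1.
have L0 : 0 < L.
  by rewrite /L ltr_wpDl// sumr_ge0// => i _; exact: rnorm_ge0.
apply/nbhs_normP; exists (eps / L) => /=; first by rewrite divr_gt0.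
move=> d /= cd; rewrite -real_combB.
apply: le_lt_trans (rnorm_real_comb_le _ _) _.
apply: (@le_lt_trans _ _ (L * `|c - d|)).
  by rewrite ler_wpM2r// /L lerDl.
by rewrite -ltr_pdivlMl// mulrC.
Qed.

Lemma continuous_rnorm_real_comb m (e : 'I_m -> Y) :
  continuous (fun c => rnorm (real_comb e c)).
Proof.
move=> c; apply/(@cvgrPdist_lt _ _ _ (nbhs c)) => eps eps0.
near=> d; apply: (@le_lt_trans _ _ (rnorm (real_comb e c - real_comb e d))).
  2: by near: d; exact: real_comb_near.
have := ler_rnormD (real_comb e c - real_comb e d) (real_comb e d).
have := ler_rnormD (real_comb e d - real_comb e c) (real_comb e c).
rewrite !subrK rnorm_distC => h1 h2.
rewrite ler_norml; apply/andP; split; lra.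
Unshelve. all: by end_near. Qed.

(** By compactness of the unit sphere of [R^m], the norm is bounded below on the
    combinations with coefficients of norm one. *)
Lemma independent_coef_bound m (e : 'I_m -> Y) :
  (forall c, real_comb e c = 0 -> c = 0) ->
  exists M, forall c, `|c| <= M * rnorm (real_comb e c).
Proof.
move=> inj; pose S := [set c : 'rV[R]_m | `|c| = 1].
have cS : compact S.
  apply: bounded_closed_compact.
    by exists 1; split=> [|x x1 c /= ->]; [exact: real1|exact: ltW].
  rewrite (_ : S = (fun c : 'rV[R]_m => `|c|) @^-1` [set x | x = 1])//.
  by apply: preimage_closed => [c _|]; [exact: norm_continuous|exact: closed_eq].
have normed c : c != 0 -> S (`|c|^-1 *: c).
  move=> c0; rewrite /S/= normrZ normfV normr_id mulVf// normr_eq0//.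
have [S0|/set0P/negP/negPn/eqP S0] := pselect (S !=set0); last first.
  exists 0 => c; have [->|/normed] := eqVneq c 0; first by rewrite normr0 mul0r.
  by rewrite S0.
have [|c0 /set_mem S_c0 minc0] := EVT_min_rV S0 cS
    (f := fun c => rnorm (real_comb e c)).
  exact/continuous_subspaceT/continuous_rnorm_real_comb.
have mu0 : 0 < rnorm (real_comb e c0).
  rewrite lt_neqAle rnorm_ge0 eq_sym rnorm_eq0 andbT.
  apply/negP => /eqP/inj c00; move: S_c0; rewrite /S/= c00 normr0.
  by move=> /esym/eqP; rewrite oner_eq0.
exists (rnorm (real_comb e c0))^-1 => c.
have [->|cn0] := eqVneq c 0.
  by rewrite normr0 mulr_ge0 ?invr_ge0 ?rnorm_ge0.
have := minc0 _ (mem_set (normed _ cn0)).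
rewrite real_combZ rnormZ_real normfV normr_id.
by rewrite -ler_pdivrMl ?invr_gt0 ?normr_gt0// invrK mulrC -ler_pdivlMl.
Qed.

Lemma compact_unit_coefs m (e : 'I_m -> Y) :
  (forall c, real_comb e c = 0 -> c = 0) ->
  compact [set c | rnorm (real_comb e c) = 1].
Proof.
move=> /independent_coef_bound[M hM]; apply: bounded_closed_compact.
  exists M; split=> [|x Mx c /= c1]; first exact: num_real.
  by apply: le_trans (ltW Mx); have := hM c; rewrite c1 mulr1.
rewrite (_ : mkset _ = (fun c => rnorm (real_comb e c)) @^-1` [set x | x = 1])//.
apply: preimage_closed => [c _|]; last exact: closed_eq.
exact: continuous_rnorm_real_comb.
Qed.

End RealCombinations.

(** * The two implications *)

Section Proposition.
Context (R : realType) (k : scalars).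
Local Notation K := (scalar_field R k).
Context (Y : normedModType K).
Implicit Types X : set Y.

(** The constant [delta] obtained at one point of the unit sphere of [X] still
    serves, after halving, on a neighbourhood of that point; compactness makes
    it uniform. *)
Lemma ssd_BPB_pair X : strongly_subdifferentiable Y ->
  linear_subspace X -> finite_dimensional X -> BPB_pair X.
Proof.
move=> ssd linX finX eps eps0.
have [m0 [e0 gen0]] := finite_dimensional_real_generators linX finX.
have [m [e [[Xe genX] inj]]] := independent_real_generators gen0.
pose P (delta : R) (c : 'rV[R]_m) := forall f0 : {linear Y -> K^o},
  dual_sphere f0 -> re (f0 (real_comb e c)) > 1 - delta ->
  exists (x : Y) (f : {linear Y -> K^o}),
    [/\ Pi_pair X (x, f), rnorm (real_comb e c - x) < eps & dual_norm (f0 \- f) < eps].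
have cov := (compact_near_coveringP _).1 (compact_unit_coefs inj).
have /cov : forall c, rnorm (real_comb e c) = 1 ->
    \forall c' \near c & delta \near 0^'+, P delta c'.
  move=> c c1.
  have [d d0 hd] := ssd_near_support c1 (ssd _ c1) (eps := eps / 2) ltac:(lra).
  have rho0 : 0 < Num.min eps (d / 2) by rewrite lt_min eps0 divr_gt0.
  exists ([set c' | rnorm (real_comb e c - real_comb e c') < Num.min eps (d / 2)],
          [set delta | delta < d / 2]) => [|[c' delta] /= [+ ldelta] f0 f0S f0c'].
    by split=> /=; [exact: real_comb_near|apply: nbhs_right_lt; rewrite divr_gt0].
  rewrite lt_min => /andP[cc'eps cc'd].
  have [|f [fS fc f0f]] := hd f0 f0S.
    have := dual_sphere_re_le f0S (real_comb e c' - real_comb e c).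
    rewrite linearB reB rnorm_distC; lra.
  exists (real_comb e c), f; split=> /=.
  - by split=> //=; exact: subspace_real_comb.
  - by rewrite rnorm_distC.
  - by apply: le_lt_trans f0f _; lra.
move=> near_P; have [delta [delta0 hdelta]] := filter_ex (filterI (nbhs_right_gt (0 : R)) near_P).
exists delta => // x0 f0 Xx0 x01 f0S; have [c x0c] := genX _ Xx0.
by rewrite x0c in x01 *; exact: hdelta.
Qed.

(** On the line spanned by [u] a point of the unit sphere close to [u] is
    [a *: u] with [a] close to [1], so multiplying by [a] turns a functional
    supported there into one supported at [u]. *)
Lemma line_BPB_near_support u : rnorm u = 1 ->
    BPB_pair [set a *: u | a in [set: K]] ->
  forall eps : R, 0 < eps -> exists2 delta : R, 0 < delta &
    forall f : {linear Y -> K^o}, dual_sphere f -> 1 - delta < re (f u) ->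
    exists g : {linear Y -> K^o},
      [/\ dual_sphere g, g u = 1 & dual_norm (f \- g) <= eps].
Proof.
move=> u1 bpb eps eps0.
have eps2 : 0 < eps / 2 by lra.
have [delta delta0 hd] := bpb _ eps2.
exists delta => // f fS fu.
have Xu : [set a *: u | a in [set: K]] u by exists 1 => //; rewrite scale1r.
have [x [g [[/= [a _ ax] x1 gS gx] ux fg]]] := hd u f Xu u1 fS fu.
pose h : {linear Y -> K^o} := a \*: g.
have gu : a * g u = 1 by rewrite -gx -ax linearZ.
have a1 : re `|a| = 1 by move: x1; rewrite /unit_sphere/= -ax rnormZ u1 mulr1.
have hN y : rnorm (h y) = rnorm (g y) by rewrite /h/= rnormZ a1 mul1r.
have [||hS hu] := support_functionalP (f := h) u1.
- move=> y; apply: le_trans (re_le_rnorm h y) _.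
  by rewrite hN; exact: dual_sphere_le.
- by rewrite /h/= /GRing.scale/= gu -(of_real1 k) re_of_real.
exists h; split=> //; apply: dual_norm_le; first exact: ltW.
move=> y /=; have -> : f y - h y = (f y - g y) + (1 - a) *: (g y).
  by rewrite /h/= scalerBl scale1r addrA subrK.
apply: le_trans (ler_rnormD _ _) _.
have h1 := dual_norm_subP (ltW eps2) fS gS (ltW fg) y.
have h2 : rnorm ((1 - a) *: (g y)) <= eps / 2 * rnorm y.
  rewrite rnormZ ler_pM ?re_ge0 ?rnorm_ge0//; last exact: dual_sphere_le.
  apply: ltW; move: ux; rewrite -ax -{1}[u]scale1r -scalerBl rnormZ u1.
  by rewrite mulr1.
by have := lerD h1 h2; rewrite -mulrDl -splitr.
Qed.

Lemma linear_subspace_line (u : Y) : linear_subspace [set a *: u | a in [set: K]].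
Proof.
split; first by exists 0; rewrite ?scale0r.
by move=> b _ _ [a _ <-] [a' _ <-]; exists (b * a + a') => //; rewrite scalerDl scalerA.
Qed.

Lemma finite_dimensional_line (u : Y) : finite_dimensional [set a *: u | a in [set: K]].
Proof.
exists 1%N, (fun=> u); split=> [_|x [a _ <-]]; first by exists 1; rewrite ?scale1r.
by exists (fun=> a); rewrite big_ord1.
Qed.

End Proposition.

Theorem proposition4p7 (R : realType) (k : scalars)
    (Y : completeNormedModType (scalar_field R k)) :
  strongly_subdifferentiable Y <->
  (forall X : set Y, linear_subspace X -> finite_dimensional X -> BPB_pair X).
Proof.
split=> [ssd X linX finX|bpb u u1]; first exact: ssd_BPB_pair.
apply: near_support_ssd => //; apply: line_BPB_near_support => //.
by apply: bpb; [exact: linear_subspace_line|exact: finite_dimensional_line].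
Qed.
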